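(* For each CT-prevariety of structures $\mathcal{A}=\mathsf{ISP}(\mathcal{M})$, with associated topological prevariety $\mathcal{A}_{\mathscr{T}}=\mathsf{IS}_{\mathrm c}\mathsf{P}(\mathcal{M}_{\mathscr{T}})$, the natural extension functor $n_{\mathcal{A}}\colon\mathcal{A}\to\mathcal{A}_{\mathscr{T}}$ is left adjoint to the functor ${}^\flat\colon\mathcal{A}_{\mathscr{T}}\to\mathcal{A}$ forgetting the topology.
   Context: A structure $\mathbf{A}=\langle A;G,H,R\rangle$ is a set $A$ with a set $G$ of finitary total operations, a set $H$ of finitary partial operations and a set $R$ of finitary relations. Products are formed coordinatewise (a partial operation is defined at a tuple iff it is defined in every coordinate); a substructure is a subset closed under the operations and under the partial operations where defined, with restricted structure; homomorphisms preserve operations, relations and partial operations (where defined). A topology on a structure is compatible with it if the relations and the domains of partial operations are topologically closed and the operations and partial operations are continuous; a topological structure is a structure with a compatible topology. All compact spaces are assumed Hausdorff. CT-prevariety: $\mathcal{M}$ is a set of structures of common signature, each $\mathbf{M}\in\mathcal{M}$ having a fixed associated compact topology $\mathscr{T}$ compatible with $\mathbf{M}$; $\mathbf{M}_{\mathscr{T}}$ denotes $\mathbf{M}$ with this topology and $\mathcal{M}_{\mathscr{T}}=\{\mathbf{M}_{\mathscr{T}}\mid\mathbf{M}\in\mathcal{M}\}$. $\mathcal{A}=\mathsf{ISP}(\mathcal{M})$ is the class of isomorphic copies of non-empty substructures of products of members of $\mathcal{M}$ (morphisms: homomorphisms). $\mathcal{A}_{\mathscr{T}}=\mathsf{IS}_{\mathrm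 c}\mathsf{P}(\mathcal{M}_{\mathscr{T}})$ is the class of isomorphic copies of non-empty topologically closed substructures of products of members of $\mathcal{M}_{\mathscr{T}}$ (morphisms: continuous homomorphisms). For $\mathbf{A}\in\mathcal{A}$, $X_{\mathbf{A}}$ is the disjoint union of the hom-sets $\mathcal{A}(\mathbf{A},\mathbf{M})$, $\mathbf{M}\in\mathcal{M}$; for $x\in\mathcal{A}(\mathbf{A},\mathbf{M})$, $\mathbf{Y}_x:=\mathbf{M}_{\mathscr{T}}$. The embedding $e_{\mathbf{A}}\colon\mathbf{A}\to\prod\{\mathbf{Y}_x\mid x\in X_{\mathbf{A}}\}$ is $e_{\mathbf{A}}(a)(x):=x(a)$. The natural extension $n_{\mathcal{A}}(\mathbf{A})$ is the smallest topologically closed substructure of $\prod\{\mathbf{Y}_x\mid x\in X_{\mathbf{A}}\}$ containing $e_{\mathbf{A}}(A)$. For a homomorphism $u\colon\mathbf{A}\to\mathbf{B}$ in $\mathcal{A}$, $n_{\mathcal{A}}(u)\colon n_{\mathcal{A}}(\mathbf{A})\to n_{\mathcal{A}}(\mathbf{B})$ is given by $n_{\mathcal{A}}(u)(f)(y):=f(y\circ u)$ for $y\in X_{\mathbf{B}}$. *)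

(* Defs.v *)
From mathcomp Require Import all_boot all_classical.
From mathcomp Require Import topology function_spaces.

Set Implicit Arguments.
Unset Strict Implicit.
Unset Printing Implicit Defensive.

Local Open Scope classical_set_scope.

Record category := Category {
  obj :> Type;
  mor : obj -> obj -> Type;
  idm : forall a, mor a a;
  cmp : forall a b c, mor b c -> mor a b -> mor a c;
  cmp1m : forall a b (u : mor a b), cmp (idm b) u = u;
  cmpm1 : forall a b (u : mor a b), cmp u (idm a) = u;
  cmpA : forall a b c d (w : mor c d) (v : mor b c) (u : mor a b),
    cmp w (cmp v u) = cmp (cmp w v) u }.

Definition isomorphic (C : category) (a b : C) : Prop :=
  exists (u : mor a b) (v : mor b a), cmp v u = idm a /\ cmp u v = idm b.

(* A dedicated record rather than [sig]: its universe must lie above that of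
   the carriers of structures, some of which are themselves [sig] types. *)
Record full_obj (C : category) (P : C -> Prop) := FullObj {
  fval : C;
  fvalP : P fval }.

Definition full_subcategory (C : category) (P : C -> Prop) : category :=
  @Category (full_obj P) (fun a b => mor (fval a) (fval b))
    (fun a => idm (fval a)) (fun a b c v u => cmp v u)
    (fun a b u => cmp1m u) (fun a b u => cmpm1 u)
    (fun a b c d w v u => cmpA w v u).

Record functor (C D : category) := Functor {
  fobj :> C -> D;
  fmap : forall a b, mor a b -> mor (fobj a) (fobj b);
  fmap1 : forall a, fmap (idm a) = idm (fobj a);
  fmapM : forall a b c (v : mor b c) (u : mor a b),
    fmap (cmp v u) = cmp (fmap v) (fmap u) }.

Definition left_adjoint (C D : category) (F : functor C D) (G : functor D C)
  : Prop :=
  exists phi : forall (c : C) (d : D), mor (F c) d -> mor c (G d),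
    (forall c d, bijective (phi c d)) /\
    (forall (c c' : C) (d d' : D) (u : mor c' c) (v : mor d d')
            (w : mor (F c) d),
       phi c' d' (cmp v (cmp w (fmap F u))) =
       cmp (fmap G v) (cmp (phi c d w) u)).

Record signature := Signature {
  opsym : Type; oparity : opsym -> nat;
  popsym : Type; poparity : popsym -> nat;
  relsym : Type; relarity : relsym -> nat }.

(* The partial operation named [h] is a total function on (the type associated
   with) its domain [pdom h], a set of tuples. *)
Record structure_on (Sg : signature) (A : Type) := StructureOn {
  oper_on : forall g : opsym Sg, ('I_(oparity g) -> A) -> A;
  pdom_on : forall h : popsym Sg, set ('I_(poparity h) -> A);
  poper_on : forall h : popsym Sg, @pdom_on h -> A;
  reln_on : forall r : relsym Sg, set ('I_(relarity r) -> A) }.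
Arguments oper_on {Sg A} s g x.
Arguments pdom_on {Sg A} s h.
Arguments poper_on {Sg A} s h x.
Arguments reln_on {Sg A} s r.

Record structure (Sg : signature) := Structure {
  carrier :> Type;
  str : structure_on Sg carrier }.

Definition oper Sg (A : structure Sg) := oper_on (str A).
Definition pdom Sg (A : structure Sg) := pdom_on (str A).
Arguments pdom {Sg} A h.
Definition poper Sg (A : structure Sg) (h : popsym Sg) : pdom A h -> A :=
  poper_on (str A) h.
Definition reln Sg (A : structure Sg) := reln_on (str A).
Arguments oper {Sg} A g x.
Arguments poper {Sg} A h x.
Arguments reln {Sg} A r.

Record is_hom Sg (A B : structure Sg) (f : A -> B) : Prop := IsHom {
  hom_oper : forall g x, f (oper A g x) = oper B g (f \o x);
  hom_poper : forall h (x : pdom A h), exists2 y : pdom B h,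
    \val y = f \o \val x & f (poper A h x) = poper B h y;
  hom_reln : forall r x, reln A r x -> reln B r (f \o x) }.

Record hom Sg (A B : structure Sg) := Hom {
  hom_fun :> A -> B;
  homP : is_hom hom_fun }.

Record is_substructure Sg (A : structure Sg) (S : set A) : Prop :=
  IsSubstructure {
  sub_oper : forall g x, (forall i, S (x i)) -> S (oper A g x);
  sub_poper : forall h (x : pdom A h),
    (forall i, S (\val x i)) -> S (poper A h x) }.

Section Basics.
Variable Sg : signature.
Implicit Types A B C : structure Sg.

Lemma poper_eq A h (x y : pdom A h) :
  \val x = \val y -> poper A h x = poper A h y.
Proof. by move=> xy; congr poper; exact: val_inj. Qed.

Lemma pdom_lift A h x : pdom A h x -> exists y : pdom A h, \val y = x.
Proof. by move=> dx; exists (exist _ x (mem_set dx)). Qed.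

Lemma hom_ext A B (u v : hom A B) : u =1 v -> u = v.
Proof.
case: u v => [u up] [v vp] /= /funext uv; subst v.
by congr Hom; exact: Prop_irrelevance.
Qed.

Lemma is_hom_id A : is_hom (id : A -> A).
Proof. by split=> // h x; exists x. Qed.

Lemma is_hom_comp A B C (v : B -> C) (u : A -> B) :
  is_hom v -> is_hom u -> is_hom (v \o u).
Proof.
move=> hv hu; split=> [g x|h x|r x xr] /=.
- by rewrite (hom_oper hu) (hom_oper hv).
- have [y yx uy] := hom_poper hu x; have [z zy vz] := hom_poper hv y.
  by exists z; rewrite ?uy // zy yx.
- exact/(hom_reln hv)/(hom_reln hu).
Qed.

Definition id_hom A : hom A A := Hom (is_hom_id A).
Definition comp_hom A B C (v : hom B C) (u : hom A B) : hom A C :=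
  Hom (is_hom_comp (homP v) (homP u)).

Definition Struct : category.
Proof.
refine (@Category (structure Sg) (@hom Sg) id_hom comp_hom _ _ _);
  by move=> *; exact: hom_ext.
Defined.

Section Product.
Variables (J : Type) (A : J -> structure Sg).

Definition prod_pdom (h : popsym Sg) : set ('I_(poparity h) -> forall j, A j) :=
  [set x | forall j, pdom (A j) h (fun k => x k j)].

Arguments prod_pdom : clear implicits.

Definition prod_pdom_coord h (x : prod_pdom h) (j : J) : pdom (A j) h :=
  exist _ (fun k => \val x k j) (mem_set (set_mem (valP x) j)).

Definition prod_str : structure_on Sg (forall j, A j) :=
  @StructureOn Sg (forall j, A j)
    (fun g x j => oper (A j) g (fun k => x k j))
    prod_pdom
    (fun h x j => poper (A j) h (prod_pdom_coord x j))
    (fun r => [set x | forall j, reln (A j) r (fun k => x k j)]).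

Definition prod_structure : structure Sg := Structure prod_str.

End Product.

Section Sub.
Variables (A : structure Sg) (S : set A) (hS : is_substructure S).

Definition sub_pdom (h : popsym Sg) : set ('I_(poparity h) -> S) :=
  [set x | pdom A h (fun k => \val (x k))].

Arguments sub_pdom : clear implicits.

Definition sub_pdom_val h (x : sub_pdom h) : pdom A h :=
  exist _ (fun k => \val (\val x k)) (valP x).

Definition sub_str : structure_on Sg S :=
  @StructureOn Sg S
    (fun g x => exist _ (oper A g (fun k => \val (x k)))
       (mem_set (sub_oper hS (fun k => set_mem (valP (x k))))))
    sub_pdom
    (fun h x => exist _ (poper A h (sub_pdom_val x))
       (mem_set (@sub_poper _ _ _ hS h (sub_pdom_val x)
          (fun k => set_mem (valP (\val x k))))))
    (fun r => [set x | reln A r (fun k => \val (x k))]).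

Definition sub_structure : structure Sg := Structure sub_str.

End Sub.

End Basics.

Record compatible Sg (T : topologicalType) (s : structure_on Sg T) : Prop :=
  Compatible {
  reln_closed : forall r, closed (reln_on s r : set {ptws _ -> T});
  pdom_closed : forall h, closed (pdom_on s h : set {ptws _ -> T});
  oper_continuous : forall g, continuous (oper_on s g : {ptws _ -> T} -> T);
  poper_continuous : forall h,
    continuous (poper_on s h : (pdom_on s h : set {ptws _ -> T}) -> T) }.

Record tstructure (Sg : signature) := TStructure {
  tcarrier :> topologicalType;
  tstr : structure_on Sg tcarrier;
  tcompat : compatible tstr }.

Definition forget Sg (X : tstructure Sg) : structure Sg := Structure (tstr X).

Record chom Sg (X Y : tstructure Sg) := CHom {
  chom_fun :> X -> Y;
  chomP : is_hom (chom_fun : forget X -> forget Y);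
  chom_continuous : continuous chom_fun }.

Section Pointwise.
Variables (J : Type).

Lemma ptws_cvgP (T : J -> topologicalType) (F : set_system (prod_topology T))
  (x : prod_topology T) : Filter F ->
  (forall j, (fun y : prod_topology T => y j) @ F --> x j) -> F --> x.
Proof.
move=> FF Fx; apply/cvg_sup => j U [_ [[W oW <-] /= Wx] /filterS]; apply.
by apply: Fx; exact: open_nbhs_nbhs.
Qed.

Lemma ptws_coord_continuous (T : J -> topologicalType) (j : J) :
  continuous (fun y : prod_topology T => y j).
Proof. exact: (@proj_continuous {classic J} T j). Qed.

Lemma ptws_continuous (X : topologicalType) (T : J -> topologicalType)
  (f : X -> prod_topology T) :
  (forall j, continuous (fun x => f x j)) -> continuous f.
Proof. by move=> cf x; apply: ptws_cvgP => j; exact: (cf j x). Qed.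

End Pointwise.

Lemma set_type_continuous (X Y : topologicalType) (B : set Y) (f : X -> B) :
  continuous (fun x => \val (f x)) -> continuous f.
Proof. by move=> cf; exact: (@continuous_comp_initial _ X Y set_val). Qed.

Lemma set_val_continuous (Y : topologicalType) (B : set Y) :
  continuous (fun x : B => \val x).
Proof. exact: initial_continuous. Qed.

Section TopBasics.
Variable Sg : signature.
Implicit Types X Y Z : tstructure Sg.

Lemma chom_ext X Y (u v : chom X Y) : u =1 v -> u = v.
Proof.
case: u v => [u up uc] [v vp vc] /= /funext uv; subst v.
by congr CHom; exact: Prop_irrelevance.
Qed.

Definition id_chom X : chom X X :=
  CHom (is_hom_id (forget X)) (fun x => @cvg_id _ (nbhs x)).

Lemma comp_continuous X Y Z (v : chom Y Z) (u : chom X Y) :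
  continuous (v \o u).
Proof.
by move=> x; apply: continuous_comp; exact: chom_continuous.
Qed.

Definition comp_chom X Y Z (v : chom Y Z) (u : chom X Y) : chom X Z :=
  CHom (is_hom_comp (chomP v) (chomP u)) (comp_continuous (v := v) (u := u)).

Definition TopStruct : category.
Proof.
refine (@Category (tstructure Sg) (@chom Sg) id_chom comp_chom _ _ _);
  by move=> *; exact: chom_ext.
Defined.

Section Product.
Variables (J : Type) (X : J -> tstructure Sg).

Lemma prod_compatible :
  @compatible Sg (prod_topology X) (prod_str (fun j => forget (X j))).
Proof.
pose P : topologicalType := prod_topology X.
have coord n j : continuous
    (fun x : {ptws 'I_n -> P} => (fun k => x k j) : {ptws 'I_n -> X j}).
  apply: ptws_continuous => k x.
  apply: (@continuous_comp _ P _ (fun x : {ptws 'I_n -> P} => x k)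
    (fun y => y j)); exact: ptws_coord_continuous.
have cl n (D : forall j, set {ptws 'I_n -> X j}) : (forall j, closed (D j)) ->
    closed ([set x | forall j, D j (fun k => x k j)] : set {ptws 'I_n -> P}).
  move=> cD; rewrite (_ : [set _ | _] = \bigcap_j
      ((fun x : {ptws 'I_n -> P} => (fun k => x k j)) @^-1` D j)).
    apply: closed_bigI => j _.
    by apply: (@preimage_closed _ {ptws 'I_n -> X j}) => [x _|];
      [exact: coord|exact: cD].
  by apply/seteqP; split=> x /= Dx j; [move=> _; exact: Dx|exact: (Dx j I)].
split.
- move=> r; apply: (cl _ (fun j => reln_on (tstr (X j)) r)) => j.
  exact: (reln_closed (tcompat (X j))).
- move=> h; apply: (cl _ (fun j => pdom_on (tstr (X j)) h)) => j.
  exact: (pdom_closed (tcompat (X j))).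
- move=> g; apply: (@ptws_continuous J {ptws _ -> P} X) => j x.
  apply: (@continuous_comp _ {ptws _ -> X j}); first exact: coord.
  exact: (oper_continuous (tcompat (X j))).
- move=> h; pose D : set {ptws _ -> P} :=
    @prod_pdom Sg J (fun j => forget (X j)) h.
  apply: (@ptws_continuous J D X) => j x.
  pose Dj : set {ptws _ -> X j} := pdom_on (tstr (X j)) h.
  pose c : D -> Dj := fun x =>
    @prod_pdom_coord Sg J (fun j => forget (X j)) h x j.
  have cc : continuous c.
    apply: set_type_continuous => {}x.
    exact: (continuous_comp (@set_val_continuous _ D x) (@coord _ j (\val x))).
  exact: (@continuous_comp D Dj (X j) c _ _ (cc x)
    (@poper_continuous _ _ _ (tcompat (X j)) h (c x))).
Qed.

Definition prod_tstructure : tstructure Sg := TStructure prod_compatible.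

End Product.

Section Sub.
Variables (X : tstructure Sg) (S : set X).
Hypothesis hS : @is_substructure Sg (forget X) S.

Lemma sub_compatible : @compatible Sg (S : Type) (sub_str hS).
Proof.
have incl n : continuous
    (fun x : {ptws 'I_n -> S} => (fun k => \val (x k)) : {ptws 'I_n -> X}).
  apply: ptws_continuous => k x.
  apply: (@continuous_comp _ S _ (fun x : {ptws 'I_n -> S} => x k)).
    exact: ptws_coord_continuous.
  exact: set_val_continuous.
split.
- move=> r; apply: (@preimage_closed _ _
    (fun x : {ptws _ -> S} => (fun k => \val (x k)) : {ptws _ -> X})
    (reln_on (tstr X) r)) => [x _|]; first exact: incl.
  exact: (reln_closed (tcompat X)).
- move=> h; apply: (@preimage_closed _ _
    (fun x : {ptws _ -> S} => (fun k => \val (x k)) : {ptws _ -> X})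
    (pdom_on (tstr X) h)) => [x _|]; first exact: incl.
  exact: (pdom_closed (tcompat X)).
- move=> g; apply: set_type_continuous => x.
  exact: (@continuous_comp {ptws _ -> S} {ptws _ -> X} X _
    (oper_on (tstr X) g) x (@incl _ x) (@oper_continuous _ _ _ (tcompat X) g _)).
- move=> h; apply: set_type_continuous => x.
  pose D : set {ptws _ -> S} := @sub_pdom Sg (forget X) S h.
  pose D' : set {ptws _ -> X} := pdom_on (tstr X) h.
  pose c : D -> D' := @sub_pdom_val Sg (forget X) S h.
  have cc : continuous c.
    apply: set_type_continuous => {}x.
    exact: (continuous_comp (@set_val_continuous _ D x) (@incl _ (\val x))).
  exact: (@continuous_comp D D' X c _ _ (cc x)
    (@poper_continuous _ _ _ (tcompat X) h (c x))).
Qed.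

Definition sub_tstructure : tstructure Sg := TStructure sub_compatible.

End Sub.

End TopBasics.

(* A set of structures is represented by a family over an arbitrary index type;
   the disjoint union of hom-sets is then taken over the indices. *)
Record ct_family (Sg : signature) := CTFamily {
  ct_index : Type;
  ct_mem :> ct_index -> tstructure Sg;
  ct_compact : forall i, compact [set: ct_mem i];
  ct_hausdorff : forall i, hausdorff_space (ct_mem i) }.

(* [J] may be empty: the empty product is allowed. *)
Definition ISP Sg (I : Type) (M : I -> structure Sg) (A : Struct Sg)
  : Prop :=
  exists (J : Type) (f : J -> I)
     (S : set (prod_structure (M \o f))) (hS : is_substructure S),
     S !=set0 /\ @isomorphic (Struct Sg) A (sub_structure hS).

Definition IScP Sg (I : Type) (M : I -> tstructure Sg)
  (X : TopStruct Sg) : Prop :=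
  exists (J : Type) (f : J -> I)
     (S : set (prod_tstructure (M \o f)))
     (hS : @is_substructure Sg (forget (prod_tstructure (M \o f))) S),
     [/\ S !=set0, closed S &
         @isomorphic (TopStruct Sg) X (sub_tstructure hS)].

Section Prevariety.
Variables (Sg : signature) (M : ct_family Sg).

Definition prevariety : category :=
  full_subcategory (ISP (fun i => forget (M i))).

Definition top_prevariety : category := full_subcategory (IScP M).

Definition forget_chom (X Y : tstructure Sg) (u : chom X Y) :
  hom (forget X) (forget Y) := Hom (chomP u).

Lemma forget_ISP (X : tstructure Sg) :
  IScP M X -> ISP (fun i => forget (M i)) (forget X).
Proof.
move=> [J [f [S [hS [S0 _ [u [v [vu uv]]]]]]]]; exists J, f, S, hS; split=> //.
exists (forget_chom u), (forget_chom v); split; apply: hom_ext => x /=.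
  exact: (congr1 (fun w : chom X X => w x) vu).
pose Y := sub_tstructure hS; exact: (congr1 (fun w : chom Y Y => w x) uv).
Qed.

Definition flat : functor top_prevariety prevariety.
Proof.
refine (@Functor top_prevariety prevariety
  (fun X => FullObj (forget_ISP (fvalP X)))
  (fun X Y u => forget_chom u) _ _); by move=> *; exact: hom_ext.
Defined.

Definition homs_to_M (A : structure Sg) : Type :=
  {i : ct_index M & hom A (forget (M i))}.

Definition hom_product (A : structure Sg) : tstructure Sg :=
  prod_tstructure (fun x : homs_to_M A => M (projT1 x)).

Definition evaluation (A : structure Sg) (a : A) : hom_product A :=
  fun x => projT2 x a.

Definition nat_ext_set (A : structure Sg) : set (hom_product A) :=
  smallest [set S | @is_substructure Sg (forget (hom_product A)) S /\ closed S]
    (range (@evaluation A)).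

Lemma nat_ext_is_substructure (A : structure Sg) :
  @is_substructure Sg (forget (hom_product A)) (@nat_ext_set A).
Proof.
split=> [g x Sx|h x Sx] T [[hT cT] eT].
  by apply: (sub_oper hT) => i; apply: (Sx i).
by apply: (sub_poper hT) => i; apply: (Sx i).
Qed.

Lemma nat_ext_closed (A : structure Sg) : closed (@nat_ext_set A).
Proof. by apply: closed_bigI => T [[]]. Qed.

Definition nat_ext (A : structure Sg) : tstructure Sg :=
  sub_tstructure (nat_ext_is_substructure A).

Lemma nat_ext_IScP (A : structure Sg) :
  ISP (fun i => forget (M i)) A -> IScP M (nat_ext A).
Proof.
move=> [J [f [S [hS [[s Ss] [_ [v _]]]]]]].
exists (homs_to_M A), (@projT1 _ _), (@nat_ext_set A),
  (nat_ext_is_substructure A); split; [|exact: nat_ext_closed|].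
  exists (evaluation (v (exist _ s (mem_set Ss)))) => T [_]; apply.
  by exists (v (exist _ s (mem_set Ss))).
by exists (idm (nat_ext A : TopStruct Sg)), (idm (nat_ext A : TopStruct Sg));
  split; exact: cmp1m.
Qed.

Section Map.
Variables (A B : structure Sg) (u : hom A B).

Definition precomp (y : homs_to_M B) : homs_to_M A :=
  existT _ (projT1 y) (comp_hom (projT2 y) u).

Definition hom_product_map (f : hom_product A) : hom_product B :=
  fun y => f (precomp y).

Lemma hom_product_map_hom :
  @is_hom Sg (forget (hom_product A)) (forget (hom_product B)) hom_product_map.
Proof.
split=> // [h x|r x xr]; last by move=> y; exact: (xr (precomp y)).
have dx : pdom (forget (hom_product B)) h (hom_product_map \o \val x).
  by move=> y; exact: (set_mem (valP x) (precomp y)).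
have [z zx] := pdom_lift dx; exists z => //.
apply: functional_extensionality_dep => y.
apply: (@poper_eq _ (forget (M (projT1 y))) h).
by move: zx => /= zx; rewrite /= zx.
Qed.

Lemma hom_product_map_continuous : continuous hom_product_map.
Proof.
by apply: ptws_continuous => y; exact: (@ptws_coord_continuous _ _ (precomp y)).
Qed.

Lemma nat_ext_stable (f : hom_product A) :
  nat_ext_set f -> nat_ext_set (hom_product_map f).
Proof.
move=> Af T [[hT cT] eT].
apply: (Af (hom_product_map @^-1` T)); split; last first.
  by move=> _ [a _ <-]; apply: eT; exists (u a).
split; last first.
  apply: (@preimage_closed (hom_product A) (hom_product B)) => // x _.
  exact: hom_product_map_continuous.
split=> [g x Tx|h x Tx] /=.
  by rewrite (hom_oper hom_product_map_hom); exact: (sub_oper hT).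
have [y yx ->] := hom_poper hom_product_map_hom x.
by apply: (sub_poper hT) => i; rewrite yx; exact: Tx.
Qed.

Definition nat_ext_fun (f : nat_ext A) : nat_ext B :=
  exist _ (fun y => \val f (precomp y))
    (mem_set (nat_ext_stable (set_mem (valP f)))).

Lemma nat_ext_fun_hom :
  @is_hom Sg (forget (nat_ext A)) (forget (nat_ext B)) nat_ext_fun.
Proof.
split=> [g x|h x|r x].
- exact: val_inj.
- have [y yx uy] := hom_poper hom_product_map_hom
    (@sub_pdom_val Sg (forget (hom_product A)) _ h x).
  have dx : pdom (forget (nat_ext B)) h (nat_ext_fun \o \val x).
    by move: (valP y); rewrite yx => /set_mem.
  have [z zx] := pdom_lift dx; exists z => //.
  apply: val_inj; apply: (etrans uy); apply: poper_eq.
  by rewrite yx /= zx.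
- exact: (hom_reln hom_product_map_hom).
Qed.

Lemma nat_ext_fun_continuous : continuous nat_ext_fun.
Proof.
apply: set_type_continuous => x.
exact: (@continuous_comp (nat_ext A) (hom_product A) (hom_product B) _ _ x
  (@set_val_continuous _ _ x) (@hom_product_map_continuous _)).
Qed.

Definition nat_ext_map : chom (nat_ext A) (nat_ext B) :=
  CHom nat_ext_fun_hom nat_ext_fun_continuous.

End Map.

Definition nat_ext_functor : functor prevariety top_prevariety.
Proof.
refine (@Functor prevariety top_prevariety
  (fun A => FullObj (nat_ext_IScP (fvalP A)))
  (fun A B u => nat_ext_map u) _ _).
- move=> A; apply: chom_ext => f; apply: val_inj => /=.
  apply: functional_extensionality_dep => -[i x].
  rewrite /precomp /=; suff -> : comp_hom x (id_hom (fval A)) = x by [].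
  exact: hom_ext.
- move=> A B C v u; apply: chom_ext => f; apply: val_inj => /=.
  apply: functional_extensionality_dep => -[i y].
  rewrite /precomp /=.
  suff -> : comp_hom y (comp_hom v u) = comp_hom (comp_hom y v) u by [].
  exact: hom_ext.
Defined.

End Prevariety.

(* Main.v *)
From mathcomp Require Import all_boot all_classical.
From mathcomp Require Import topology function_spaces.
Require Import Defs.

(** The evaluation [A -> n(A)] is a homomorphism and is the unit of the
    adjunction. A continuous homomorphism out of [n(A)] is determined by its
    values on evaluations, since the equaliser of two of them is a closed
    substructure (the codomain being Hausdorff). Conversely, let [X] be a closed
    substructure of a product of members of [M] and [g : A -> X] a
    homomorphism. The coordinates of [g] are elements of the index set of the
    product containing [n(A)], so the projection onto these coordinates maps
    the evaluation at [a] to [g a], and by minimality maps [n(A)] into [X]. *)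

Set Implicit Arguments.
Unset Strict Implicit.
Unset Printing Implicit Defensive.

Local Open Scope classical_set_scope.

(** * Homomorphisms into products and substructures; transport of substructures *)

Section Structures.
Variable Sg : signature.
Implicit Types A B : structure Sg.

Lemma is_hom_proj (J : Type) (B : J -> structure Sg) (j : J) :
  is_hom (fun x : prod_structure B => x j).
Proof. by split=> // h x; exists (prod_pdom_coord x j). Qed.

Lemma is_hom_tuple A (J : Type) (B : J -> structure Sg)
  (f : A -> prod_structure B) :
  (forall j, is_hom (fun a => f a j)) -> is_hom f.
Proof.
move=> hf; split=> [g x|h x|r x xr].
- by apply: functional_extensionality_dep => j; exact: (hom_oper (hf j)).
- have dx : pdom (prod_structure B) h (f \o \val x).
    move=> j; have [y yx _] := hom_poper (hf j) x.
    by move: (set_mem (valP y)); rewrite yx.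
  have [z zx] := pdom_lift dx; exists z => //.
  apply: functional_extensionality_dep => j.
  have [y yx ->] := hom_poper (hf j) x.
  by apply: (@poper_eq _ (B j) h); rewrite yx /= zx.
- by move=> j; exact: (hom_reln (hf j)).
Qed.

Lemma is_hom_val B (S : set B) (hS : is_substructure S) :
  is_hom (fun x : sub_structure hS => \val x).
Proof. by split=> // h x; exists (sub_pdom_val x). Qed.

Lemma is_hom_corestrict A B (S : set B) (hS : is_substructure S)
  (f : A -> sub_structure hS) :
  is_hom (fun a => \val (f a)) -> is_hom f.
Proof.
move=> hf; split=> [g x|h x|r x xr].
- by apply: val_inj; exact: (hom_oper hf).
- have [y yx fy] := hom_poper hf x.
  have dx : pdom (sub_structure hS) h (f \o \val x).
    by move: (set_mem (valP y)); rewrite yx.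
  have [z zx] := pdom_lift dx; exists z => //.
  apply: val_inj; rewrite fy; apply: poper_eq.
  by rewrite yx /= zx.
- exact: (hom_reln hf).
Qed.

Lemma preimage_substructure A B (f : A -> B) (S : set B) :
  is_hom f -> is_substructure S -> is_substructure (f @^-1` S).
Proof.
move=> hf hS; split=> [g x Sx|h x Sx] /=.
  by rewrite (hom_oper hf); exact: (sub_oper hS).
have [y yx ->] := hom_poper hf x.
by apply: (sub_poper hS) => i; rewrite yx; exact: Sx.
Qed.

Lemma equalizer_substructure A B (u v : A -> B) :
  is_hom u -> is_hom v -> is_substructure [set a | u a = v a].
Proof.
move=> hu hv; split=> [g x|h x] xE /=.
  rewrite (hom_oper hu) (hom_oper hv); congr oper.
  by apply/funext => i; exact: xE.
have [y yx ->] := hom_poper hu x; have [z zx ->] := hom_poper hv x.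
by apply: poper_eq; rewrite yx zx; apply/funext => i; exact: xE.
Qed.

(** Minimality of n(A) concerns subsets of the ambient product, whereas equalisers live on the
    carrier of n(A); this moves the latter into the former. *)
Lemma image_substructure A (S : set A) (hS : is_substructure S)
  (T : set (sub_structure hS)) :
  is_substructure T ->
  is_substructure ((fun x : sub_structure hS => \val x) @` T).
Proof.
move=> hT; split=> [g x Tx|h x Tx].
  (* Choice lifts the tuple [x] coordinatewise to a tuple in [T], where closure under the operation
     applies. *)
  have [y yP] : exists y, forall i, T (y i) /\ \val (y i) = x i.
    suff /choice[y yP] : forall i, exists z, T z /\ \val z = x i by exists y.
    by move=> i; have [z Tz zx] := Tx i; exists z.
  exists (oper (sub_structure hS) g y).
    by apply: (sub_oper hT) => i; case: (yP i).
  by congr (oper A g _); apply/funext => i; case: (yP i).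
have [y yP] : exists y, forall i, T (y i) /\ \val (y i) = \val x i.
  suff /choice[y yP] : forall i, exists z, T z /\ \val z = \val x i by exists y.
  by move=> i; have [z Tz zx] := Tx i; exists z.
have yx : (fun i => \val (y i)) = \val x.
  by apply/funext => i; case: (yP i).
have dy : pdom (sub_structure hS) h y.
  by move: (set_mem (valP x)); rewrite -yx.
have [z zy] := pdom_lift dy.
exists (poper (sub_structure hS) h z).
  by apply: (sub_poper hT) => i; rewrite zy; case: (yP i).
by apply: (@poper_eq _ A h); rewrite -yx -zy.
Qed.

End Structures.

(** * Hausdorff spaces and closed sets *)

Lemma hausdorff_separating (X : topologicalType) (J : Type)
  (Y : J -> topologicalType) (f : forall j, X -> Y j) :
  (forall j, hausdorff_space (Y j)) -> (forall j, continuous (f j)) ->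
  (forall x y, (forall j, f j x = f j y) -> x = y) -> hausdorff_space X.
Proof.
move=> hY cf sep x y xy; apply: sep => j; apply: hY => A B Ax By.
by have [z [Az Bz]] := xy _ _ (cf j x _ Ax) (cf j y _ By); exists (f j z).
Qed.

Lemma closed_equalizer (X Y : topologicalType) (u v : X -> Y) :
  hausdorff_space Y -> continuous u -> continuous v ->
  closed [set x | u x = v x].
Proof.
(* At a closure point [x], the preimages of [A] and [B] meet in a neighbourhood of [x], which
   contains a point of the equaliser; its common value lies in both. *)
move=> hY cu cv x Ex; apply: hY => A B Au Bv.
have [z [/= uv [Az Bz]]] :=
  Ex _ (@filterI _ (nbhs x) _ _ _ (cu x _ Au) (cv x _ Bv)).
by exists (u z); split=> //; rewrite uv.
Qed.

Lemma closed_image_val (X : topologicalType) (S : set X) (T : set S) :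
  closed S -> closed T -> closed ((fun x : S => \val x) @` T).
Proof.
(* The complement of [T] is the trace on [S] of an open [W] of [X]. *)
move=> cS /closed_openC [W oW WT].
rewrite (_ : _ @` _ = S `&` ~` W); first exact: closedI cS (open_closedC oW).
apply/seteqP; split=> [_ [x Tx <-]|x [Sx nWx]].
  split; first exact: (set_mem (valP x)).
  by move=> Wx; have : (~` T) x by rewrite -WT.
exists (exist _ x (mem_set Sx)) => //.
by apply: contrapT => nT; apply: nWx; move: nT; rewrite -[~ _]/((~` T) _) -WT.
Qed.

(** The coordinates of the embedding [p] are continuous into Hausdorff spaces, and they separate
    points because [q] is a left inverse of [p]. *)
Lemma IScP_hausdorff (Sg : signature) (M : ct_family Sg) (X : tstructure Sg) :
  IScP M X -> hausdorff_space X.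
Proof.
move=> [J [f [S [hS [_ _ [p [q [qp _]]]]]]]].
apply: (@hausdorff_separating X J (fun j => M (f j))
  (fun j x => \val (p x) j)) => [j|j|x y xy].
- exact: ct_hausdorff.
- move=> x; pose P := prod_tstructure (M \o f).
  apply: (@continuous_comp X P (M (f j)) (fun x => \val (p x)) (fun y => y j)).
    apply: (@continuous_comp X S P p (fun y => \val y)).
      exact: (@chom_continuous _ X (sub_tstructure hS)).
    exact: set_val_continuous.
  exact: ptws_coord_continuous.
- have pxy : p x = p y.
    by apply: val_inj; apply: functional_extensionality_dep => j; exact: xy.
  have qpE z : q (p z) = z.
    exact: (congr1 (fun w : chom X X => w z) qp).
  by rewrite -(qpE x) -(qpE y) pxy.
Qed.

(** * The unit and its universal property *)

Section Unit.
Variables (Sg : signature) (M : ct_family Sg).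

Lemma evaluation_in (A : structure Sg) (a : A) :
  nat_ext_set (@evaluation Sg M A a).
Proof. by move=> T [_]; apply; exists a. Qed.

Definition unit_fun (A : structure Sg) (a : A) : nat_ext M A :=
  exist _ (evaluation a) (mem_set (evaluation_in a)).

Lemma unit_is_hom (A : structure Sg) :
  @is_hom Sg A (forget (nat_ext M A)) (@unit_fun A).
Proof.
apply: (@is_hom_corestrict _ A (forget (hom_product M A))).
apply: (@is_hom_tuple _ A _ (fun x : homs_to_M M A => forget (M (projT1 x)))).
by case=> i x; exact: homP.
Qed.

Definition unit_hom (A : structure Sg) : hom A (forget (nat_ext M A)) :=
  Hom (@unit_is_hom A).

Lemma nat_ext_hom_ext (A : structure Sg) (X : tstructure Sg)
  (u v : chom (nat_ext M A) X) :
  hausdorff_space X -> (forall a, u (unit_fun a) = v (unit_fun a)) -> u = v.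
Proof.
move=> hX uv; apply: chom_ext => f.
pose E : set (nat_ext M A) := [set f | u f = v f].
(* Minimality is applied to the image of [E] in the product; injectivity of [\val] then puts [f]
   itself in [E]. *)
have /(_ _)[] := set_mem (valP f)
  ((fun x : nat_ext M A => \val x) @` E) _; last first.
- by move=> g Eg /val_inj <-.
- split; last by move=> _ [a _ <-]; exists (unit_fun a) => //; exact: uv.
  split.
    apply: (@image_substructure _ (forget (hom_product M A)) _
      (nat_ext_is_substructure M A)).
    exact: (equalizer_substructure (chomP u) (chomP v)).
  apply: closed_image_val; first exact: nat_ext_closed.
  exact: (@closed_equalizer (nat_ext M A) X u v hX
    (@chom_continuous _ _ _ u) (@chom_continuous _ _ _ v)).
Qed.

Lemma nat_ext_hom_extend (A : structure Sg) (X : tstructure Sg)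
  (g : hom A (forget X)) :
  IScP M X -> exists w : chom (nat_ext M A) X, forall a, w (unit_fun a) = g a.
Proof.
move=> [J [f [S [hS [_ cS [p [q [qp _]]]]]]]].
pose P := prod_tstructure (M \o f).
pose Y : tstructure Sg := sub_tstructure hS.
pose coord_hom j : hom (forget P) (forget (M (f j))) :=
  Hom (is_hom_proj (fun j => forget (M (f j))) j).
pose g' : hom A (forget P) :=
  comp_hom (Hom (is_hom_val hS)) (comp_hom (forget_chom p) g).
pose idx j : homs_to_M M A :=
  existT _ (f j) (comp_hom (coord_hom j) g').
pose W (h : hom_product M A) : P := fun j => h (idx j).
have W_hom : @is_hom Sg (forget (hom_product M A)) (forget P) W.
  apply: (@is_hom_tuple _ (forget (hom_product M A)) _
    (fun j => forget (M (f j)))) => j.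
  exact: (is_hom_proj (fun x : homs_to_M M A => forget (M (projT1 x))) (idx j)).
have W_cont : continuous W.
  apply: (@ptws_continuous J (hom_product M A) (fun j => M (f j))) => j.
  exact: (@ptws_coord_continuous _ _ (idx j)).
(* The preimage of [S] under [W] is a closed substructure, and it contains each evaluation since [W]
   sends the one at [a] to [p (g a)]. *)
have WS h : nat_ext_set h -> S (W h).
  move=> /(_ (W @^-1` S)); apply; split; last first.
    by move=> _ [a _ <-]; exact: (set_mem (valP (p (g a)))).
  split; first exact: (preimage_substructure W_hom hS).
  apply: (@preimage_closed (hom_product M A) P) => // x _; exact: W_cont.
pose V (h : nat_ext M A) : Y := exist _ (W (\val h))
  (mem_set (WS _ (set_mem (valP h)))).
have V_hom : @is_hom Sg (forget (nat_ext M A)) (forget Y) V.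
  apply: (@is_hom_corestrict _ (forget (nat_ext M A)) (forget P)).
  exact: (is_hom_comp W_hom (is_hom_val (nat_ext_is_substructure M A))).
have V_cont : continuous V.
  apply: set_type_continuous => x.
  exact: (@continuous_comp (nat_ext M A) (hom_product M A) P _ W x
    (@set_val_continuous _ _ x) (@W_cont _)).
(* [X] is only isomorphic to [Y], so [q] brings the map back and cancels the [p] used in [g']. *)
exists (comp_chom q (CHom V_hom V_cont)) => a /=.
have -> : V (unit_fun a) = p (g a) by exact: val_inj.
exact: (congr1 (fun w : chom X X => w (g a)) qp).
Qed.

End Unit.

Theorem corollary3p8 (Sg : signature) (M : ct_family Sg) :
  left_adjoint (nat_ext_functor M) (flat M).
Proof.
exists (fun (A : prevariety M) (X : top_prevariety M)
  (w : chom (nat_ext M (fval A)) (fval X)) =>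
  comp_hom (forget_chom w) (unit_hom M (fval A))).
split=> [A X|A A' X X' u v w]; last first.
  (* Naturality comes down to [nat_ext_map u] sending the evaluation at [a] to the one at [u a]. *)
  apply: hom_ext => a /=; congr (v (w _)); exact: val_inj.
(* Choosing an extension of each [g] gives the inverse of restriction along the unit. *)
have [w wP] := choice (fun g : hom (fval A) (forget (fval X)) =>
  nat_ext_hom_extend g (fvalP X)).
exists w => [v|g]; last by apply: hom_ext => a; exact: wP.
by apply: nat_ext_hom_ext => [|a]; [exact: IScP_hausdorff (fvalP X)|exact: wP].
Qed.
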